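(* Let $r \ge 3$. There exists $t_0=t_0(r)$ such that for every integer $t\ge t_0$ the following holds. Suppose that $G \subseteq \mathbb{N}^{(r)}$ is an $r$-graph with $\binom{t-1}{r} \le |G| \le \binom{t}{r}$ that maximises the Lagrangian among $r$-graphs with $|G|$ edges, and suppose that $w$ is a maximal weighting of $G$ which is decreasing and satisfies $w(x) > 0$ for every non-isolated vertex $x$ of $G$. Then $G \subseteq [t]^{(r)}$.
   Context: $\mathbb{N}^{(r)}$ is the set of $r$-subsets of $\mathbb{N}=\{1,2,\dots\}$ and $[t]^{(r)}$ the set of $r$-subsets of $[t]=\{1,\dots,t\}$. An $r$-graph is a finite subset of $\mathbb{N}^{(r)}$; a non-isolated vertex is an element lying in some edge. A weighting of $\mathbb{N}$ is $w:\mathbb{N}\to[0,\infty)$ with $\sum_x w(x)=1$; $w(G)=\sum_{e\in G}\prod_{x\in e}w(x)$; the Lagrangian is $\lambda(G)=\max_w w(G)$, and $w$ is a maximal weighting of $G$ if $w(G)=\lambda(G)$. A weighting is decreasing if $w(i)\ge w(j)$ whenever $i<j$. *)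

(* Defs.v *)
From HB Require Import structures.
From mathcomp Require Import all_boot all_order all_algebra.
From mathcomp Require Import finmap.
From mathcomp Require Import all_classical all_reals all_analysis.
Set Implicit Arguments. Unset Strict Implicit. Unset Printing Implicit Defensive.
Import Order.TTheory GRing.Theory Num.Theory.
Import numFieldNormedType.Exports.
Local Open Scope classical_set_scope.
Local Open Scope ring_scope.
Local Open Scope fset_scope.

(* An r-graph: a finite set of r-subsets of N = {1,2,...} (0 is excluded). *)
Definition is_rgraph (r : nat) (G : {fset {fset nat}}) : Prop :=
  forall e, e \in G -> #|` e| = r /\ 0%N \notin e.

(* A weighting of N = {1,2,...}: nonnegative, total mass 1.  It is encoded as a
   function on nat with the dummy value w 0 = 0. *)
Definition weighting (R : realType) (w : nat -> R) : Prop :=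
  w 0%N = 0 /\ (forall x, 0 <= w x) /\ (series w @ \oo --> (1 : R)).

Definition wgt (R : realType) (w : nat -> R) (G : {fset {fset nat}}) : R :=
  \sum_(e <- G) \prod_(x <- e) w x.

(* Lagrangian: max (here: sup, which is attained) of w(G) over weightings *)
Definition lagrangian (R : realType) (G : {fset {fset nat}}) : R :=
  sup [set wgt w G | w in [set w : nat -> R | weighting w]].

Definition decreasing_w (R : realType) (w : nat -> R) : Prop :=
  forall i j : nat, (1 <= i)%N -> (i < j)%N -> w j <= w i.

Definition nonisolated (G : {fset {fset nat}}) (x : nat) : Prop :=
  exists2 e, e \in G & x \in e.

Definition within_t (t : nat) (G : {fset {fset nat}}) : Prop :=
  forall e, e \in G -> forall x, x \in e -> (1 <= x <= t)%N.

(* Main.v *)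
Require Import Defs.
From HB Require Import structures.
From mathcomp Require Import all_boot all_order all_algebra.
From mathcomp Require Import finmap.
From mathcomp Require Import all_classical all_reals all_analysis.
From mathcomp Require Import ring lra zify.
Import Order.TTheory GRing.Theory Num.Theory.
Import numFieldNormedType.Exports.
Local Open Scope fset_scope.
Local Open Scope ring_scope.

(** Let [T] be the largest vertex of [G], put [n = t - 1], and suppose [T > t].  Maximality
    forces the Lagrangian to be [(1 - O(1/n)) / r!], and the Lagrange condition says that
    every vertex has a link of weight [r] times the Lagrangian.  Expanding [w(G)] to second
    order yields [w x = O(1/n)] and [\sum_x w x ^ 2 <= 1/n + O(1/n^2)].  By Cauchy-Schwarz
    every degree is at least [(1 - O(1/n)) n^(r-1) / (r-1)!], hence [T <= n + O(1)] by
    counting edges, and, for a constant [B], [w (T - B)] has order at least [1/n].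
    Now replace the edges through [T] by as many missing edges inside [[1, T - 1]], of
    which there are enough because [|G| <= C(T - 1, r)].  After rescaling this loses
    only [O(w T ^ 2)], since the first order terms cancel.  All but [O(n^(r-2))] of the new
    edges meet the last [B] vertices at most once, so the gain is at least a constant
    multiple of [w T].  As [w T = O(1/n)], the gain exceeds the loss for large [n]. *)

(** * Uniform families on an initial segment, their links, and complete families *)

(** The bound [N] lets vertex sums be finite sums over [i < N]. Vertex 0 is allowed, since
    weightings vanish there. *)
Definition kgraph (k N : nat) (H : {fset {fset nat}}) : Prop :=
  forall e, e \in H -> #|` e| = k /\ (forall x, x \in e -> (x < N)%N).

(** Its weight is the partial derivative of [wgt v H] in the coordinate [v x]. *)
Definition link (x : nat) (H : {fset {fset nat}}) : {fset {fset nat}} :=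
  [fset e `\ x | e in [fset e in H | x \in e]].

Definition ksets (V : {fset nat}) (k : nat) : {fset {fset nat}} :=
  [fset A in fpowerset V | #|` A| == k].

Definition upd {R : nmodType} (v : nat -> R) (x : nat) (a : R) : nat -> R :=
  fun y => if y == x then a else v y.

Implicit Types (x k N : nat) (H : {fset {fset nat}}) (V : {fset nat}).

Lemma in_ksets V k A : (A \in ksets V k) = (A `<=` V) && (#|` A| == k).
Proof. by rewrite !inE /= fpowersetE. Qed.

Lemma card_ksets V k : #|` ksets V k| = 'C(#|` V|, k).
Proof.
rewrite [in RHS]cardfE -(card_draws V k).
pose f (Y : {set V}) : {fset nat} := [fset val y | y in Y].
have finj : injective f.
  by move=> A B /fsetP E; apply/setP => a; have := E (val a); rewrite !inE.
have cf (Y : {set V}) : #|` f Y| = #|Y|.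
  by rewrite card_imfset /= -?cardE //; exact: val_inj.
have -> : ksets V k = [fset f Y | Y in [set A : {set V} | #|A| == k]].
  apply/fsetP => A; rewrite in_ksets; apply/andP/imfsetP => [[AV Ak]|[Y]] /=.
    have E : A = f [set x : V | val x \in A].
      apply/fsetP => a; apply/idP/imfsetP => /= [aA|[x + ->]]; last by rewrite inE.
      by exists [` fsubsetP AV a aA]; rewrite ?inE.
    by exists [set x : V | val x \in A]; rewrite // inE -cf -E.
  rewrite inE => Yk ->; rewrite cf; split=> //.
  by apply/fsubsetP => a /imfsetP[y _ ->]; exact: valP.
by rewrite card_imfset //= -cardE.
Qed.

Lemma card_iota_fset (n : nat) : #|` [fset x in iota 1 n]| = n.
Proof. by rewrite card_fseq undup_id ?iota_uniq // size_iota. Qed.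

Lemma in_iota_fset (n x : nat) : (x \in [fset x in iota 1 n]) = (0 < x <= n)%N.
Proof. by rewrite in_fset [LHS]mem_iota add1n ltnS. Qed.

Lemma link_inj x H : {in [fset e in H | x \in e] &, injective (fun e : {fset nat} => e `\ x)}.
Proof.
move=> e f; rewrite !inE /= => /andP[_ xe] /andP[_ xf] E.
by rewrite -(fsetD1K xe) E fsetD1K.
Qed.

Lemma card_link x H : #|` link x H| = #|` [fset e in H | x \in e]|.
Proof. by apply: card_in_imfset => //=; exact: link_inj. Qed.

Lemma kgraph_link k N x H : kgraph k.+1 N H -> kgraph k N (link x H).
Proof.
move=> kH f /imfsetP[e /=]; rewrite !inE /= => /andP[/kH [ek eN] xe] ->.
split; first by move: ek; rewrite (cardfsD1 x) xe => -[].
by move=> y; rewrite !inE => /andP[_ /eN].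
Qed.

Lemma notin_link x H e : e \in link x H -> x \notin e.
Proof. by move=> /imfsetP[f /= _ ->]; rewrite !inE eqxx. Qed.

Lemma bin2_leq_sqr k : ('C(k, 2) <= k ^ 2)%N.
Proof. by rewrite bin2 -mulnn leq_half_double -mul2n; nia. Qed.

(** * The weight polynomial: coordinate changes, Euler's identity, upper bounds *)

Section Weights.
Variable R : realType.
Implicit Types (v : nat -> R).

Lemma eq_wgt v v' H : (forall e x, e \in H -> x \in e -> v x = v' x) ->
  wgt v H = wgt v' H.
Proof.
move=> E; rewrite /wgt big_seq [RHS]big_seq; apply: eq_bigr => e eH.
by rewrite big_seq [RHS]big_seq; apply: eq_bigr => x; apply: E.
Qed.

Lemma wgt_ge0 v H : (forall x, 0 <= v x) -> 0 <= wgt v H.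
Proof. by move=> v0; apply: sumr_ge0 => e _; apply: prodr_ge0. Qed.

Lemma wgt_link v x H :
  v x * wgt v (link x H) = \sum_(e <- H | x \in e) \prod_(y <- e) v y.
Proof.
rewrite /wgt big_imfset /=; last exact: link_inj.
rewrite big_distrr /= [RHS]big_fset_condE big_seq [RHS]big_seq.
apply: eq_bigr => e; rewrite !inE /= => /andP[_ xe].
by rewrite [RHS](big_fsetD1 x).
Qed.

Lemma wgt_upd_link v x a H : wgt (upd v x a) (link x H) = wgt v (link x H).
Proof.
apply: eq_wgt => e y /notin_link xe ye; rewrite /upd.
by case: eqP ye => // ->; rewrite (negbTE xe).
Qed.

Lemma wgt_split v x H :
  wgt v H = wgt v [fset e in H | x \notin e] + v x * wgt v (link x H).
Proof.
rewrite wgt_link /wgt (big_fsetID _ (fun e : {fset nat} => x \in e)) /= addrC.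
by congr (_ + _); rewrite [RHS]big_fset_condE.
Qed.

(** Edges are sets, so the polynomial is affine in each coordinate, and the slope does not involve
    [v x]. *)
Lemma wgt_upd v x a H :
  wgt (upd v x a) H = wgt v H + (a - v x) * wgt v (link x H).
Proof.
rewrite (wgt_split _ x) (wgt_split v x) wgt_upd_link {2}/upd eqxx.
rewrite (_ : wgt (upd v x a) _ = wgt v [fset e in H | x \notin e]); first ring.
apply: eq_wgt => e y; rewrite !inE /= => /andP[_ xe] ye; rewrite /upd.
by case: eqP ye => // ->; rewrite (negbTE xe).
Qed.

Lemma sum_upd (F : R -> R) v x a N : (x < N)%N ->
  \sum_(i < N) F (upd v x a i) = \sum_(i < N) F (v i) - F (v x) + F a.
Proof.
move=> xN; rewrite (bigD1 (Ordinal xN)) //= [X in _ = X - _ + _](bigD1 (Ordinal xN)) //=.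
have -> : \sum_(i < N | i != Ordinal xN) F (upd v x a i) =
          \sum_(i < N | i != Ordinal xN) F (v i).
  apply: eq_bigr => i /eqP ix; rewrite /upd; case: eqP => // E.
  by case: ix; apply: val_inj.
by rewrite [upd v x a x]/upd eqxx [X in _ = X + _]addrAC subrr add0r addrC.
Qed.

Lemma card_in_ord N (e : {fset nat}) : (forall x, x \in e -> (x < N)%N) ->
  #|` e| = #|[pred i : 'I_N | val i \in e]|.
Proof.
move=> eN; rewrite cardE -(size_map val).
apply/perm_size/uniq_perm.
- exact: fset_uniq.
- by rewrite map_inj_uniq ?enum_uniq //; exact: val_inj.
move=> x; apply/idP/mapP => [xe|[i]].
  by exists (Ordinal (eN x xe)); rewrite ?mem_enum ?inE.
by rewrite mem_enum inE => ie ->.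
Qed.

(** Euler's identity for a homogeneous polynomial of degree [k]: each edge is counted once for each
    of its vertices. *)
Lemma sum_wgt_link v k N H : kgraph k N H ->
  \sum_(x < N) v x * wgt v (link x H) = k%:R * wgt v H.
Proof.
move=> kH.
rewrite (eq_bigr (fun x : 'I_N => \sum_(e <- H) if val x \in e then \prod_(y <- e) v y else 0)); last first.
  by move=> x _; rewrite wgt_link big_mkcond.
rewrite exchange_big /= /wgt big_distrr /= big_seq [RHS]big_seq.
apply: eq_bigr => e /kH [<- eN]; rewrite -big_mkcond /= sumr_const.
by rewrite (card_in_ord _ _ eN) mulr_natl.
Qed.

Lemma wgt0_le1 v N H : kgraph 0 N H -> wgt v H <= 1.
Proof.
move=> kH; have : H `<=` [fset fset0].
  by apply/fsubsetP => e /kH [/cardfs0_eq -> _]; rewrite !inE.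
rewrite fsubset1 => /orP[] /eqP ->; rewrite /wgt.
  by rewrite big_seq_fset1 big_seq_fset0.
by rewrite big_seq_fset0 ler01.
Qed.

(** Expanding the power of the sum produces every edge monomial [k!] times; Euler's identity makes
    this an induction through links. *)
Lemma wgt_le_mass v k N H : (forall x, 0 <= v x) -> kgraph k N H ->
  k`!%:R * wgt v H <= (\sum_(i < N) v i) ^+ k.
Proof.
move=> v0; elim: k H => [|k IH] H kH.
  by rewrite fact0 mul1r expr0; apply: wgt0_le1 kH.
rewrite factS natrM mulrAC -(sum_wgt_link v _ _ _ kH) mulr_suml exprS mulr_suml.
apply: ler_sum => x _; rewrite -mulrA; apply: ler_wpM2l => //.
by rewrite mulrC; apply: IH; apply: kgraph_link.
Qed.

(* Expansion to second order, by induction on [k] through the links: passing to the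
   link of [x] costs mass [v x <= b], and averaging the cost produces the
   sum of squares. *)
Lemma wgt_le_second_order (b P : R) (r : nat) v k N H :
  0 <= P <= b -> (forall x, 0 <= v x <= b) ->
  let s := \sum_(i < N) v i in
  s <= 1 -> (k <= r)%N -> 1 - s <= (r - k)%:R * b ->
  P - (r - k)%:R * b ^+ 2 <= \sum_(i < N) v i ^+ 2 ->
  kgraph k N H ->
  k`!%:R * wgt v H <= 1 - k%:R * (1 - s) - 'C(k, 2)%:R * P
                     + 3 * r%:R ^+ 3 * k%:R * b ^+ 2.
Proof.
move=> /andP[P0 Pb]; elim: k v H => [|k IH] v H vb s s1 kr us Ps kH.
  rewrite fact0 mul1r bin0n !mul0r mulr0 mul0r !subr0 addr0; apply: wgt0_le1 kH.
rewrite factS natrM mulrAC -(sum_wgt_link v _ _ _ kH) mulr_suml.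
set u := 1 - s in us *.
have b0 : 0 <= b by case/andP: (vb 0%N) => /le_trans h /h.
set K : R := 3 * r%:R ^+ 3 * k%:R * b ^+ 2.
(* The induction hypothesis is used with coordinate [x] set to 0. This keeps the weight of the link,
   raises the deficit [u] to [u + v x], and lowers the sum of squares by at most [b ^+ 2]; the slack
   [r - k] pays for both changes. *)
have step (x : 'I_N) : v x * wgt v (link x H) * k`!%:R <=
   v x * (1 - k%:R * (u + v x) - 'C(k, 2)%:R * P + K).
  rewrite -mulrA; apply: ler_wpM2l; first by case/andP: (vb x).
  rewrite mulrC -(wgt_upd_link v x 0).
  have kb : ((r - k)%:R : R) = (r - k.+1)%:R + 1 by rewrite natr1; congr _%:R; lia.
  have /andP[vx0 vxb] := vb x.
  have E := sum_upd id v x 0 N (ltn_ord x); rewrite /= addr0 in E.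
  have E2 := sum_upd (fun z => z ^+ 2) v x 0 N (ltn_ord x); rewrite /= expr0n addr0 in E2.
  have := IH (upd v x 0) (link x H); cbv zeta; rewrite E E2.
  rewrite (_ : 1 - (\sum_(i < N) v i - v x) = u + v x); last by rewrite /u /s; ring.
  apply.
  - by move=> y; rewrite /upd; case: ifP; rewrite ?lexx ?b0.
  - by rewrite lerBlDr (le_trans s1) // lerDl.
  - exact: ltnW.
  - by rewrite kb mulrDl mul1r lerD.
  - rewrite kb mulrDl mul1r opprD addrA lerB //.
    by rewrite lerXn2r ?nnegrE.
  - exact: kgraph_link.
apply: le_trans; first by apply: ler_sum => x _; exact: step.
set c : R := 'C(k, 2)%:R.
rewrite (eq_bigr (fun x : 'I_N => v x * (1 - k%:R * u - c * P + K) - k%:R * v x ^+ 2)); last first.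
  by move=> x _; rewrite expr2; ring.
rewrite sumrB -mulr_suml -mulr_sumr -/s.
have -> : s = 1 - u by rewrite /u; ring.
have u0 : 0 <= u by rewrite /u subr_ge0.
have binE : ('C(k.+1, 2)%:R : R) = c + k%:R by rewrite /c binS bin1 natrD.
rewrite binE -natr1.
have rb : (r - k.+1)%:R <= r%:R :> R by rewrite ler_nat leq_subr.
have ur : u <= r%:R * b by apply: le_trans us _; apply: ler_wpM2r.
have Pr : P - r%:R * b ^+ 2 <= \sum_(i < N) v i ^+ 2.
  by apply: le_trans Ps; rewrite lerB // ler_wpM2r // sqr_ge0.
have K0 : 0 <= K by rewrite /K !mulr_ge0 ?ler0n ?exprn_ge0.
have k0 : 0 <= k%:R :> R by [].
have c0 : 0 <= c by rewrite /c.
have r1 : 1 <= r%:R :> R by rewrite ler1n; exact: leq_ltn_trans (leq0n k) kr.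
have kr' : k%:R <= r%:R :> R by rewrite ler_nat ltnW.
have cr : c <= r%:R ^+ 2.
  rewrite /c -natrX ler_nat; apply: leq_trans (bin2_leq_sqr k) _.
  by rewrite leq_exp2r // ltnW.
(* Three errors arise: [k * u ^+ 2], [c * (u * P)], and the cost of replacing the sum of squares by
   [P]. Each is at most [r ^+ 3 * b ^+ 2], whence the factor 3 in the error term. *)
have h1 : k%:R * u ^+ 2 <= r%:R ^+ 3 * b ^+ 2.
  rewrite (exprS r%:R 2) -mulrA -exprMn; apply: ler_pM => //; first exact: sqr_ge0.
  by rewrite lerXn2r ?nnegrE // mulr_ge0.
have h2 : c * (u * P) <= r%:R ^+ 3 * b ^+ 2.
  rewrite (exprSr r%:R 2) -mulrA; apply: ler_pM => //; first exact: mulr_ge0.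
  by rewrite expr2 mulrA; apply: ler_pM.
have h3 : k%:R * (r%:R * b ^+ 2) <= r%:R ^+ 3 * b ^+ 2.
  rewrite mulrA; apply: ler_wpM2r; first exact: sqr_ge0.
  rewrite (exprS r%:R 2); apply: ler_pM => //; rewrite -[X in X <= _]mulr1 expr2.
  by apply: ler_pM.
have h4 : 0 <= u * K by apply: mulr_ge0.
have h5 : k%:R * (P - r%:R * b ^+ 2) <= k%:R * (\sum_(i < N) v i ^+ 2) by apply: ler_wpM2l.
have -> : 3 * r%:R ^+ 3 * (k%:R + 1) * b ^+ 2 = K + 3 * (r%:R ^+ 3 * b ^+ 2).
  by rewrite /K; ring.
move: h1 h2 h3 h4 h5.
set X := r%:R ^+ 3 * b ^+ 2; set S2 := \sum_(i < N) _; set Y := r%:R * b ^+ 2.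
rewrite mulrBr expr2 => h1 h2 h3 h4 h5.
have -> : (1 - u) * (1 - k%:R * u - c * P + K) - k%:R * S2 =
  1 - u - k%:R * u + k%:R * (u * u) - c * P + c * (u * P) + K - u * K - k%:R * S2 by ring.
have -> : 1 - (k%:R + 1) * u - (c + k%:R) * P + (K + 3 * X) =
  1 - k%:R * u - u - c * P - k%:R * P + K + 3 * X by ring.
lra.
Qed.

End Weights.

(** * The Lagrangian: homogeneity and the first-order condition *)

Section Lagrangian.
Variable R : realType.
Implicit Types (v w : nat -> R) (G : {fset {fset nat}}).
Local Open Scope classical_set_scope.

Lemma expr1D_le (h : R) n : -1 <= h <= 1 ->
  (1 + h) ^+ n <= 1 + n%:R * h + 4 ^+ n * h ^+ 2.
Proof.
move=> /andP[h1 h2]; elim: n => [|n IH].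
  by rewrite !expr0 mul0r addr0 mul1r lerDl sqr_ge0.
have h0 : 0 <= 1 + h by lra.
rewrite exprS; apply: le_trans (ler_wpM2l h0 IH) _.
have n4 : n%:R <= 4 ^+ n :> R by rewrite -natrX ler_nat ltnW // ltn_expl.
have s0 := sqr_ge0 h.
have c0 : 0 <= (4 : R) ^+ n * h ^+ 2 by rewrite mulr_ge0 // exprn_ge0.
have a1 : n%:R * h ^+ 2 <= 4 ^+ n * h ^+ 2 by apply: ler_wpM2r.
have a2 : h * (4 ^+ n * h ^+ 2) <= 4 ^+ n * h ^+ 2.
  by rewrite -[X in _ <= X]mul1r; apply: ler_wpM2r.
rewrite (exprS 4 n) -[n.+1%:R]natr1.
have -> : (1 + h) * (1 + n%:R * h + 4 ^+ n * h ^+ 2) =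
  1 + (n%:R + 1) * h + n%:R * h ^+ 2 + 4 ^+ n * h ^+ 2 + h * (4 ^+ n * h ^+ 2) by ring.
have -> : 4 * 4 ^+ n * h ^+ 2 = 4 * ((4 : R) ^+ n * h ^+ 2) by ring.
lra.
Qed.

Lemma wgtZ (c : R) v k H : (forall e, e \in H -> #|` e| = k) ->
  wgt (fun x => c * v x) H = c ^+ k * wgt v H.
Proof.
move=> kH; rewrite /wgt big_distrr /= big_seq [RHS]big_seq.
apply: eq_bigr => e /kH <-; rewrite big_split /= big_const_seq count_predT.
by rewrite iter_mulr_1.
Qed.

Lemma series_le_lim v (s : R) n : (forall x, 0 <= v x) ->
  series v @ \oo --> s -> series v n <= s.
Proof.
move=> v0 vs; have cv : cvgn (series v) by apply/cvg_ex; exists s.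
rewrite -(cvg_lim _ vs) //; apply: nondecreasing_cvgn_le => //.
by apply/nondecreasing_seqP => k; rewrite /series /= big_nat_recr //= lerDl.
Qed.

Lemma weighting_le1 w x : weighting w -> w x <= 1.
Proof.
move=> [_ [w0 ws]]; apply: le_trans (series_le_lim _ _ x.+1 w0 ws).
by rewrite /series /= big_nat_recr //= lerDr sumr_ge0.
Qed.

Lemma wgt_le_lagrangian w H : weighting w -> wgt w H <= lagrangian R H.
Proof.
move=> ww; apply: ub_le_sup; last by exists w.
(* The supremum is over a bounded set: weights are at most 1, so every monomial is too. *)
exists #|` H|%:R => _ [v vv <-]; rewrite /wgt.
rewrite [leRHS](_ : _ = \sum_(e <- H) 1); last first.
  by rewrite big_const_seq count_predT iter_addr_0.
apply: ler_sum => e _.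
suff /andP[] : 0 <= \prod_(x <- e) v x <= 1 by [].
elim/big_ind : _ => [|a b /andP[a0 a1] /andP[b0 b1]|x _]; first by rewrite ler01 lexx.
  by rewrite mulr_ge0 // mulr_ile1.
by rewrite weighting_le1 //; case: vv => _ [->].
Qed.

(** Dividing [v] by its mass [s] gives a weighting, and the weight is homogeneous of degree [r]. *)
Lemma lagrangian_scaled v H r (s : R) : is_rgraph r H ->
  v 0%N = 0 -> (forall x, 0 <= v x) -> series v @ \oo --> s -> 0 < s ->
  wgt v H <= lagrangian R H * s ^+ r.
Proof.
move=> rH v0 vp vs s0.
have ww : weighting (fun x => s^-1 * v x).
  split; first by rewrite v0 mulr0.
  split; first by move=> x; rewrite mulr_ge0 // invr_ge0 ltW.
  rewrite -(mulVf (lt0r_neq0 s0)).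
  rewrite [X in X @ _](_ : _ = (fun n => s^-1 * series v n)); last first.
    by apply/funext => n; rewrite /series /= big_distrr.
  by apply: cvgMr.
have := wgt_le_lagrangian _ H ww.
rewrite (@wgtZ _ _ r); last by move=> e /rH [].
by rewrite exprVn mulrC ler_pdivrMr // exprn_gt0.
Qed.

Lemma series_finsupp v N : (forall x, (N <= x)%N -> v x = 0) ->
  series v @ \oo --> \sum_(i < N) v i.
Proof.
move=> vN; apply: cvg_near_cst; exists N => // n /= Nn.
rewrite /series /= (big_cat_nat (n := N)) //= [X in _ + X]big1_seq ?addr0 ?big_mkord //.
by move=> i /andP[_]; rewrite mem_index_iota => /andP[/vN].
Qed.

Lemma lagrangian_finsupp v H r N : is_rgraph r H ->
  v 0%N = 0 -> (forall x, 0 <= v x) -> (forall x, (N <= x)%N -> v x = 0) ->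
  0 < \sum_(i < N) v i ->
  wgt v H <= lagrangian R H * (\sum_(i < N) v i) ^+ r.
Proof. by move=> rH v0 vp /series_finsupp; apply: lagrangian_scaled. Qed.

Lemma series_upd v x a (s : R) : series v @ \oo --> s ->
  series (upd v x a) @ \oo --> s + (a - v x).
Proof.
move=> vs.
suff : (fun n => series v n + (a - v x)) @ \oo --> s + (a - v x).
  apply: cvg_trans; apply: near_eq_cvg; exists x.+1 => // n /= xn.
  rewrite /series /= !big_mkord.
  by have /= -> := sum_upd R id v x a n xn; ring.
by apply: cvgD => //; exact: cvg_cst.
Qed.

(* The Lagrange multiplier condition, from varying one coordinate and using homogeneity. *)
Lemma wgt_link_maximal w G r x : is_rgraph r G -> weighting w ->
  wgt w G = lagrangian R G -> (0 < x)%N -> 0 < w x ->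
  wgt w (link x G) = r%:R * lagrangian R G.
Proof.
move=> rG ww wG x0 wx; have [w0 [wp ws]] := ww.
set l := lagrangian R G; set D := wgt w (link x G).
have l0 : 0 <= l by rewrite /l -wG wgt_ge0.
have wx1 := weighting_le1 _ x ww.
(* Adding [h] to [w x] changes the weight by [h * D] and the mass by [h]; comparing with
   [l * (1 + h) ^+ r] leaves a quadratic error. The range of [h] keeps the coordinate
   nonnegative. *)
have key (h : R) : `|h| <= w x / 2 -> h * (D - r%:R * l) <= l * 4 ^+ r * h ^+ 2.
  rewrite ler_norml => /andP[h1 h2].
  have := @lagrangian_scaled (upd w x (w x + h)) G r (1 + (w x + h - w x)) rG.
  rewrite wgt_upd wG -/l -/D (_ : w x + h - w x = h); last by ring.
  have h3 : -1 <= h <= 1 by apply/andP; split; lra.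
  move=> K; have {K} : l + h * D <= l * (1 + h) ^+ r.
    apply: K.
    - by rewrite /upd; case: eqP x0 => [<-|].
    - by move=> y; rewrite /upd; case: ifP => // _; lra.
    - rewrite (_ : h = w x + h - w x); last by ring.
      have -> : w x + (w x + h - w x) = w x + h by ring.
      exact: series_upd.
    - lra.
  have := ler_wpM2l l0 (expr1D_le _ r h3).
  have -> : l * (1 + r%:R * h + 4 ^+ r * h ^+ 2) =
            l + h * (r%:R * l) + l * 4 ^+ r * h ^+ 2 by ring.
  by rewrite mulrBr; lra.
apply/eqP; rewrite -subr_eq0; apply/eqP; move: key; set d := D - _ => key.
have C0 : 0 <= l * 4 ^+ r by rewrite mulr_ge0 // exprn_ge0.
move: key C0; set C := l * _ => key C0.
have key' (e : R) : 0 < e -> e <= w x / 2 -> `|d| <= C * e.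
  move=> e0 ex; rewrite ler_norml; have ee : `|e| <= w x / 2 by rewrite gtr0_norm.
  have := key e ee; have := key (- e); rewrite normrN => /(_ ee).
  rewrite sqrrN expr2 mulNr mulrA => k1 k2.
  by apply/andP; split; rewrite -(ler_pM2l e0); lra.
have [//|ne] := eqVneq d 0; exfalso.
have d0 : 0 < `|d| by rewrite normr_gt0.
have C1 : 0 < C + 1 by lra.
(* Taking [h] equal to [e] and [- e] has given [|d| <= C * e] for small [e]; the second entry of the
   minimum makes [C * e] smaller than [|d|]. *)
have e0 : 0 < Num.min (w x / 2) (`|d| / (2 * (C + 1))).
  by rewrite lt_min !divr_gt0 // mulr_gt0.
have := key' _ e0; rewrite ge_min lexx => /(_ isT).
apply/negP; rewrite -ltNge.
apply: (@le_lt_trans _ _ (C * (`|d| / (2 * (C + 1))))).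
  by apply: ler_wpM2l => //; rewrite ge_min lexx orbT.
rewrite mulrA ltr_pdivrMr; last by rewrite mulr_gt0.
nra.
Qed.

End Lagrangian.

(** * Elementary inequalities *)

Section RealFacts.
Variable R : realType.

Lemma bernoulli_le (x : R) k : 0 <= x <= 1 -> 1 - k%:R * x <= (1 - x) ^+ k.
Proof.
move=> /andP[x0 x1]; elim: k => [|k IH]; first by rewrite expr0 mul0r subr0.
have y0 : 0 <= 1 - x by lra.
rewrite exprS; apply: le_trans (ler_wpM2l y0 IH).
have : 0 <= k%:R * x ^+ 2 by rewrite mulr_ge0 // sqr_ge0.
by rewrite -natr1; nra.
Qed.

Lemma cauchy_seq (I : Type) (s : seq I) (a : I -> R) :
  (\sum_(i <- s) a i) ^+ 2 <= (size s)%:R * \sum_(i <- s) a i ^+ 2.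
Proof.
case: s => [|i0 s]; first by rewrite !big_nil expr0n mulr0.
set l := i0 :: s; set n : R := (size l)%:R; set S := \sum_(i <- l) a i.
have n0 : 0 < n by rewrite ltr0n.
have : 0 <= \sum_(i <- l) (n * a i - S) ^+ 2 by apply: sumr_ge0 => i _; exact: sqr_ge0.
have -> : \sum_(i <- l) (n * a i - S) ^+ 2 =
  n ^+ 2 * (\sum_(i <- l) a i ^+ 2) - 2 * n * S * S + n * S ^+ 2.
  rewrite (eq_bigr (fun i => n ^+ 2 * a i ^+ 2 + (- (2 * n * S)) * a i + S ^+ 2)); last first.
    by move=> i _; ring.
  rewrite !big_split /= -!mulr_sumr -/S big_const_seq count_predT iter_addr_0 -/n.
  by rewrite -mulr_natl -/n; ring.
set M := \sum_(i <- l) _.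
have -> : n ^+ 2 * M - 2 * n * S * S + n * S ^+ 2 = n * (n * M - S ^+ 2) by ring.
by rewrite pmulr_rge0 // subr_ge0.
Qed.

(** The product of the factors [1 - i / n] over [i < k] is at least 1 minus the sum of the [i / n],
    and these [i] sum to ['C(k, 2)]. *)
Lemma ffact_ge n k : (0 < n)%N -> (k <= n)%N ->
  (n%:R : R) ^+ k * (1 - 'C(k, 2)%:R / n%:R) <= (n ^_ k)%:R.
Proof.
move=> n0; elim: k => [_|k IH kn].
  by rewrite bin0n mul0r subr0 mulr1 expr0 ffactn0.
have np : 0 < n%:R :> R by rewrite ltr0n.
have nk : 0 <= (n - k)%:R :> R by [].
rewrite ffactnSr natrM; apply: le_trans (ler_wpM2r nk (IH (ltnW kn))).
rewrite natrB ?(ltnW kn) // binS bin1 natrD exprSr.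
have -> : n%:R - k%:R = n%:R * (1 - k%:R / n%:R) :> R.
  by rewrite mulrBr mulr1 mulrCA divff ?mulr1 // gt_eqF.
rewrite -!mulrA; apply: ler_wpM2l; first by rewrite exprn_ge0 // ltW.
rewrite mulrCA; apply: ler_wpM2l; first exact: ltW.
have a0 : 0 <= 'C(k, 2)%:R / n%:R :> R by rewrite divr_ge0.
have b0 : 0 <= k%:R / n%:R :> R by rewrite divr_ge0.
by rewrite mulrDl; nra.
Qed.

End RealFacts.

(** * Lower bound for the Lagrangian of an extremal graph *)

Implicit Types (r n : nat) (G : {fset {fset nat}}).

Lemma ffact_le_expn n k : (n ^_ k <= n ^ k)%N.
Proof.
elim: k => // k IH; rewrite ffactnSr expnSr; apply: leq_mul => //.
exact: leq_subr.
Qed.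

Lemma fset_between (K : choiceType) (A B : {fset K}) k : A `<=` B ->
  (#|` A| <= k <= #|` B|)%N -> exists C : {fset K}, [/\ A `<=` C, C `<=` B & #|` C| = k].
Proof.
move=> AB /andP[Ak kB].
pose D := [fset x in take (k - #|` A|) (enum_fset (B `\` A))].
have DBA : D `<=` B `\` A by apply/fsubsetP => x; rewrite in_fset /= => /mem_take.
exists (A `|` D); split; first exact: fsubsetUl.
  by rewrite fsubUset AB (fsubset_trans DBA) // fsubDset fsubsetUr.
rewrite cardfsU (_ : A `&` D = fset0) ?cardfs0 ?subn0; last first.
  apply/eqP; rewrite -fsubset0; apply/fsubsetP => x; rewrite in_fsetI => /andP[xA xD].
  by have := fsubsetP DBA x xD; rewrite in_fsetD xA.
rewrite card_fseq undup_id ?take_uniq ?fset_uniq // size_take cardfsDS //.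
by case: ltnP; lia.
Qed.

Section LowerBound.
Variable R : realType.

Lemma wgt_cst (c : R) k H : (forall e, e \in H -> #|` e| = k) ->
  wgt (fun=> c) H = c ^+ k *+ #|` H|.
Proof.
move=> kH; have -> : (fun=> c) = (fun x : nat => c * 1) :> (nat -> R).
  by apply/funext => x; rewrite mulr1.
rewrite (wgtZ _ _ _ _ _ kH) -mulr_natr; congr (_ * _); rewrite /wgt.
rewrite (eq_bigr (fun=> 1)) => [|e _]; last by rewrite big1.
by rewrite big_const_seq count_predT iter_addr_0.
Qed.

(** The competitor is a graph with as many edges as [G] that contains all [r]-subsets of [[1, n]],
    tested at the uniform weighting of [[1, n]]. *)
Lemma lagrangian_extremal_ge r n G : (0 < n)%N -> (r <= n)%N -> is_rgraph r G ->
  ('C(n, r) <= #|` G| <= 'C(n.+1, r))%N ->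
  (forall H, is_rgraph r H -> #|` H| = #|` G| -> lagrangian R H <= lagrangian R G) ->
  1 - 'C(r, 2)%:R / n%:R <= r`!%:R * lagrangian R G.
Proof.
move=> n0 rn rG Gn Gmax.
pose V k := [fset x in iota 1 k] : {fset nat}.
have V0 k x : x \in V k -> x != 0%N.
  by rewrite in_iota_fset -lt0n => /andP[].
have sub : ksets (V n) r `<=` ksets (V n.+1) r.
  apply/fsubsetP => e; rewrite !in_ksets => /andP[eV ->]; rewrite andbT.
  apply: fsubset_trans eV _; apply/fsubsetP => x; rewrite !in_iota_fset.
  by move=> /andP[-> /= /leqW].
have [|H [H1 H2 Hc]] := fset_between _ _ _ #|` G| sub.
  by rewrite !card_ksets !card_iota_fset.
have rH : is_rgraph r H.
  move=> e /(fsubsetP H2); rewrite in_ksets => /andP[/fsubsetP eV /eqP ->].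
  by split=> //; apply/negP => /eqP /eqP /eV /V0.
apply: le_trans (ler_wpM2l _ (Gmax H rH Hc)); last by [].
have np : 0 < n%:R :> R by rewrite ltr0n.
pose v (x : nat) : R := if x \in V n then n%:R^-1 else 0.
have ww : weighting v.
  split; first by rewrite /v; case: ifP => // /V0.
  split; first by move=> x; rewrite /v; case: ifP => // _; rewrite invr_ge0.
  have -> : (1 : R) = \sum_(i < n.+1) v i.
    rewrite big_ord_recl {1}/v; case: ifP => [/V0 //|_]; rewrite add0r.
    rewrite (eq_bigr (fun=> n%:R^-1)) => [|i _].
      by rewrite sumr_const card_ord -[RHS]mulr_natr mulVf // gt_eqF.
    by rewrite /v in_iota_fset ltn_ord.
  apply: series_finsupp => x nx; rewrite /v; case: ifP => //.
  by rewrite in_iota_fset (leqNgt x n) nx andbF.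
have h := wgt_le_lagrangian _ _ H ww.
have f0 : 0 < r`!%:R :> R by rewrite ltr0n fact_gt0.
apply: le_trans (ler_wpM2l (ltW f0) h).
have sb : wgt v (ksets (V n) r) <= wgt v H.
  rewrite /wgt [leRHS](big_fsetID _ (mem (ksets (V n) r))) /=.
  have -> : [fset x in H | x \in ksets (V n) r] = ksets (V n) r.
    apply/fsetP => e; rewrite in_fset [LHS]inE /=.
    by apply/andP/idP => [[]//|he]; split=> //; apply: (fsubsetP H1).
  by rewrite lerDl sumr_ge0 // => e _; apply: prodr_ge0 => x _; case: ww => _ [->].
apply: le_trans (ler_wpM2l (ltW f0) sb).
rewrite (eq_wgt _ _ (fun=> n%:R^-1)); last first.
  move=> e x; rewrite in_ksets => /andP[/fsubsetP eV _] /eV; rewrite /v => ->//.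
rewrite (wgt_cst _ r) => [|e]; last by rewrite in_ksets => /andP[_ /eqP].
rewrite card_ksets card_iota_fset exprVn -[X in _ <= _ * X]mulr_natr mulrCA [leRHS]mulrC.
rewrite ler_pdivlMr ?exprn_gt0 // mulrC -natrM mulnC bin_ffact.
exact: ffact_ge.
Qed.

End LowerBound.

(** * Weights, degrees and support size of an extremal graph *)

Section Extremal.
Variables (R : realType) (p n T : nat) (G : {fset {fset nat}}) (w : nat -> R) (l : R).
Local Notation r := p.+2.
Local Notation q := ('C(r, 2)%:R : R).
Local Notation d := (n%:R^-1 : R).
(** [K1], [K2] and [K3] control the error terms for the sum of squares, the degrees and the number
    of vertices, respectively. *)
Local Notation K1 := (3 * r%:R ^+ 4 * q).
Local Notation K2 := (2 * q + r%:R * K1).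
Local Notation K3 := (4 * K2 + 1).
Hypotheses (n0 : (0 < n)%N) (kG : kgraph r T.+1 G).
Hypotheses (wp : forall x, 0 <= w x) (w1 : \sum_(i < T.+1) w i = 1).
Hypothesis wT : forall x, ~~ (0 < x <= T)%N -> w x = 0.
Hypothesis wG : wgt w G = l.
Hypothesis wL : forall x, (0 < x <= T)%N -> wgt w (link x G) = r%:R * l.
Hypothesis lge : 1 - q * d <= r`!%:R * l.

Let np : 0 < n%:R :> R. Proof. by rewrite ltr0n. Qed.
Let d0 : 0 < d. Proof. by rewrite invr_gt0. Qed.
Let q1 : 1 <= q. Proof. by rewrite ler1n bin_gt0. Qed.

Let factl x : (0 < x <= T)%N -> r`!%:R * l = p.+1`!%:R * wgt w (link x G).
Proof. by move=> xT; rewrite wL // factS natrM mulrA (mulrC r%:R) -mulrA. Qed.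

(** The link of [x] lives on mass [1 - w x], so [r! * l] is at most [(1 - w x) ^+ p.+1], hence at
    most [1 - w x]; compare with [lge]. *)
Lemma weight_le x : w x <= q * d.
Proof.
have [xT|/wT ->] := boolP (0 < x <= T)%N; last by rewrite mulr_ge0 // ltW.
have xN : (x < T.+1)%N by case/andP: xT.
have mass : \sum_(i < T.+1) upd w x 0 i = 1 - w x.
  by have /= -> := sum_upd R id w x 0 T.+1 xN; rewrite addr0 w1.
have up : forall y, 0 <= upd w x 0 y by move=> y; rewrite /upd; case: ifP.
have := wgt_le_mass R _ _ _ _ up (kgraph_link _ _ x _ kG).
rewrite wgt_upd_link mass -factl // => h.
have m0 : 0 <= 1 - w x by rewrite -mass sumr_ge0.
have : (1 - w x) ^+ p.+1 <= 1 - w x.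
  by rewrite exprS ler_piMr // exprn_ile1 // lerBlDr lerDl.
by move: lge; lra.
Qed.

Let P := \sum_(i < T.+1) w i ^+ 2.

Let P_ge0 : 0 <= P. Proof. by apply: sumr_ge0 => i _; exact: sqr_ge0. Qed.

(** The second-order bound at full mass, with [b = q * d], reads [r! * l <= 1 - q * P + O(d ^+ 2)].
    Against [lge] the factor [q] cancels, so the leading coefficient is exactly 1. *)
Lemma sum_sqr_le : P <= d * (1 + K1 * d).
Proof.
have Pb : 0 <= P <= q * d.
  rewrite P_ge0 /= -[leRHS]mulr1 -[X in _ <= _ * X]w1 mulr_sumr; apply: ler_sum => i _.
  by rewrite expr2; apply: ler_wpM2r => //; exact: weight_le.
have wb x : 0 <= w x <= q * d by rewrite wp weight_le.
have := wgt_le_second_order R _ _ r w r T.+1 G Pb wb; cbv zeta.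
rewrite w1 subnn !mul0r subrr subr0 => /(_ (lexx _) (leqnn _) (lexx _) (lexx _) kG).
rewrite mulr0 subr0 wG.
have -> : 3 * r%:R ^+ 3 * r%:R * (q * d) ^+ 2 = q * (K1 * d ^+ 2) by ring.
move=> h; rewrite -(ler_pM2l (lt_le_trans ltr01 q1)).
have -> : q * (d * (1 + K1 * d)) = q * d + q * (K1 * d ^+ 2) by ring.
by move: lge; lra.
Qed.

Let deg x : R := #|` link x G|%:R.

(** Cauchy-Schwarz over the edges of the link; the squared monomials sum to the weight of the link
    under [w ^+ 2], whose mass is [P]. *)
Lemma sqr_le_deg x : (0 < x <= T)%N -> (r`!%:R * l) ^+ 2 <= deg x * p.+1`!%:R * P ^+ p.+1.
Proof.
move=> xT; rewrite (factl x xT).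
have := cauchy_seq R _ (enum_fset (link x G)) (fun e => \prod_(y <- e) w y).
rewrite -/(wgt w (link x G)) -/(deg x).
rewrite (eq_bigr (fun e : {fset nat} => \prod_(y <- e) w y ^+ 2)); last by move=> e _; rewrite prodrXl.
rewrite -/(wgt (fun y => w y ^+ 2) (link x G)) => h1.
have h2 := wgt_le_mass R (fun y => w y ^+ 2) _ _ _ (fun y => sqr_ge0 (w y)) (kgraph_link _ _ x _ kG).
rewrite -/P in h2; rewrite exprMn; have f0 : 0 <= p.+1`!%:R :> R by [].
have de : 0 <= deg x by [].
apply: le_trans (ler_wpM2l (mulr_ge0 de f0) h2).
rewrite (expr2 p.+1`!%:R).
apply: le_trans (ler_wpM2l (mulr_ge0 f0 f0) h1) _.
by rewrite le_eqVlt; apply/orP; left; apply/eqP; ring.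
Qed.

Lemma deg_ge x : K2 * d <= 1 -> (0 < x <= T)%N ->
  n%:R ^+ p.+1 * (1 - K2 * d) <= deg x * p.+1`!%:R.
Proof.
move=> K2d xT.
have k0 : 0 <= K1 by rewrite !mulr_ge0 // exprn_ge0.
have kd0 : 0 <= K1 * d by rewrite mulr_ge0 // ltW.
have kd1 : r%:R * (K1 * d) <= 1.
  have h : 0 <= 2 * q * d by rewrite !mulr_ge0 // ltW.
  by move: K2d; lra.
have qd : 2 * (q * d) <= 1.
  have h : 0 <= r%:R * (K1 * d) by rewrite mulr_ge0.
  by move: K2d; lra.
move: kd0 kd1 (sum_sqr_le) K2d => + + + +.
have -> : K2 * d = 2 * (q * d) + r%:R * (K1 * d) by ring.
have qd0 : 0 <= q * d by rewrite mulr_ge0 // ltW.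
move: qd0 qd lge (sqr_le_deg x xT).
set X := K1 * d; set Q := q * d; set L := r`!%:R * l; set D := deg x * _.
move=> Q0 Q1 LQ LD X0 rX PX K2d.
have D0 : 0 <= D by rewrite /D mulr_ge0.
have X1 : X <= 1.
  apply: le_trans rX; rewrite -[leLHS]mul1r; apply: ler_wpM2r => //.
  by rewrite ler1n.
have L2 : 1 - 2 * Q <= L ^+ 2.
  have : 0 <= Q ^+ 2 by exact: sqr_ge0.
  have : (1 - Q) ^+ 2 <= L ^+ 2 by rewrite lerXn2r ?nnegrE; lra.
  by rewrite sqrrB; lra.
have PX' : P ^+ p.+1 <= d ^+ p.+1 * (1 + X) ^+ p.+1.
  by rewrite -exprMn lerXn2r ?nnegrE // mulr_ge0 // ?ltW //; lra.
have b0 : 0 <= (1 - X) ^+ p.+1 by rewrite exprn_ge0 // subr_ge0.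
(* Multiplying by [(1 - X) ^+ p.+1] replaces division by [(1 + X) ^+ p.+1]. Bernoulli then
   contributes the part [r * K1] of [K2], and squaring [1 - Q] the part [2 * q]. *)
have ab : (1 + X) ^+ p.+1 * (1 - X) ^+ p.+1 <= 1.
  rewrite -exprMn exprn_ile1 //; first by rewrite mulr_ge0; lra.
  by have : 0 <= X ^+ 2 := sqr_ge0 X; lra.
have bX : 1 - r%:R * X <= (1 - X) ^+ p.+1.
  have := @bernoulli_le R X p.+1; rewrite X0 X1 => /(_ isT) /(le_trans _); apply.
  by rewrite lerB // ler_wpM2r // ler_nat.
have main : 1 - (2 * Q + r%:R * X) <= D * d ^+ p.+1.
  have e1 : (1 - 2 * Q) * (1 - r%:R * X) <= (1 - 2 * Q) * (1 - X) ^+ p.+1.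
    by apply: ler_wpM2l => //; lra.
  have e2 : (1 - 2 * Q) * (1 - X) ^+ p.+1 <=
     D * (d ^+ p.+1 * (1 + X) ^+ p.+1) * (1 - X) ^+ p.+1.
    apply: ler_wpM2r => //; apply: le_trans L2 _; apply: le_trans LD _.
    exact: ler_wpM2l.
  have e3 : D * (d ^+ p.+1 * (1 + X) ^+ p.+1) * (1 - X) ^+ p.+1 <= D * d ^+ p.+1.
    have -> : D * (d ^+ p.+1 * (1 + X) ^+ p.+1) * (1 - X) ^+ p.+1 =
              D * d ^+ p.+1 * ((1 + X) ^+ p.+1 * (1 - X) ^+ p.+1) by rewrite !mulrA.
    by apply: ler_piMr; rewrite // mulr_ge0 // exprn_ge0 // ltW.
  have e4 : 0 <= (2 * Q) * (r%:R * X) by rewrite !mulr_ge0.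
  move: e1; rewrite mulrBl mul1r mulrBr mulr1; lra.
have n1 : 0 <= n%:R ^+ p.+1 :> R by rewrite exprn_ge0.
apply: le_trans (ler_wpM2l n1 main) _.
by rewrite mulrCA -exprMn divff ?expr1n ?mulr1 // gt_eqF.
Qed.

(** The degrees sum to [r * |G|], and each of the [T] vertices has degree bounded below by
    [deg_ge]. *)
Lemma support_le : (#|` G| <= 'C(n.+1, r))%N -> K2 * d <= 2^-1 -> T%:R <= n%:R + K3.
Proof.
move=> Gn K2d; have K2d' : K2 * d <= 1 by move: K2d; lra.
have degE x : wgt (fun=> 1 : R) (link x G) = deg x.
  rewrite (wgt_cst _ _ p.+1) ?expr1n // => e eL.
  by case: (kgraph_link _ _ x _ kG e eL).
have sumd : \sum_(x < T.+1) deg x = r%:R * #|` G|%:R.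
  have := sum_wgt_link R (fun=> 1) _ _ _ kG.
  rewrite (wgt_cst _ _ r) ?expr1n => [<-|e /kG[]//].
  by apply: eq_bigr => x _; rewrite mul1r degE.
have f0 : 0 <= p.+1`!%:R :> R by [].
have low : T%:R * (n%:R ^+ p.+1 * (1 - K2 * d)) <= r`!%:R * #|` G|%:R.
  rewrite factS natrM [leRHS]mulrAC -sumd mulr_suml big_ord_recl.
  have -> : T%:R * (n%:R ^+ p.+1 * (1 - K2 * d)) =
            \sum_(i < T) (n%:R ^+ p.+1 * (1 - K2 * d)).
    by rewrite sumr_const card_ord mulr_natl.
  rewrite -[leLHS]add0r; apply: lerD; first by rewrite mulr_ge0.
  by apply: ler_sum => i _; apply: deg_ge => //=.
have high : r`!%:R * #|` G|%:R <= (n%:R + 1) * n%:R ^+ p.+1 :> R.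
  rewrite natr1 -natrX -!natrM ler_nat; apply: (@leq_trans (r`! * 'C(n.+1, r))).
    by rewrite leq_mul2l Gn orbT.
  by rewrite mulnC bin_ffact ffactSS leq_mul2l ffact_le_expn orbT.
have n1 : 0 < n%:R ^+ p.+1 :> R by rewrite exprn_gt0.
have Tn : T%:R * (1 - K2 * d) <= n%:R + 1.
  rewrite -(ler_pM2r n1); apply: le_trans high; apply: le_trans low.
  by rewrite -[leLHS]mulrA [in leLHS](mulrC (1 - _)).
have K20 : 0 <= K2 by rewrite addr_ge0 ?mulr_ge0 ?exprn_ge0.
have d1 : d <= 1 by rewrite invf_le1 // ler1n.
have nd : n%:R * d = 1 by rewrite divff // gt_eqF.
have Z0 := mulr_ge0 K20 (ltW d0).
move: Tn K2d K20 nd Z0; set Z := K2 * d => Tn Z2 K20 nd Z0.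
have T0 : 0 <= T%:R :> R by [].
(* For [Z <= 1/2], the factor [1 + 2 * Z] dominates the inverse of [1 - Z]. *)
have e1 : T%:R <= T%:R * (1 - Z) * (1 + 2 * Z).
  rewrite -mulrA ler_peMr //.
  have -> : (1 - Z) * (1 + 2 * Z) = 1 + Z * (1 - 2 * Z) by ring.
  by rewrite lerDl mulr_ge0 //; lra.
have e2 : T%:R * (1 - Z) * (1 + 2 * Z) <= (n%:R + 1) * (1 + 2 * Z).
  by apply: ler_wpM2r => //; lra.
have e3 : (n%:R + 1) * (1 + 2 * Z) = n%:R + 1 + 2 * K2 + 2 * Z.
  have -> : (n%:R + 1) * (1 + 2 * Z) = n%:R + 1 + 2 * K2 * (n%:R * d) + 2 * Z.
    by rewrite /Z; ring.
  by rewrite nd mulr1.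
have e4 : Z <= K2 by rewrite /Z ler_piMr.
move: K20 e1 e2 e3 e4; set KK := K2; lra.
Qed.

(** Otherwise the last [B] vertices weigh less than [d / 2] together, and Cauchy-Schwarz on the
    first [a = T - B] gives [(1 - d / 2) ^+ 2 <= a * P]. But [a <= n - K1 - 2] forces
    [a * P <= 1 - 2 * d]. *)
Lemma weight_tail_ge (B : nat) : K3 + K1 + 2 <= B%:R -> T%:R <= n%:R + K3 -> (B < T)%N ->
  (forall i j, (0 < i)%N -> (i < j)%N -> w j <= w i) ->
  d / 2 <= B%:R * w (T - B)%N.
Proof.
move=> BK TK BT wdec; rewrite leNgt; apply/negP => small.
set a := (T - B)%N in small.
have a0 : (0 < a)%N by rewrite subn_gt0.
have aT : (a.+1 <= T.+1)%N by rewrite ltnS leq_subr.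
have sumE (f : nat -> R) : \sum_(i < T.+1) f i =
    f 0%N + \sum_(1 <= i < a.+1) f i + \sum_(a.+1 <= i < T.+1) f i.
  rewrite -(big_mkord xpredT f) (big_cat_nat (n := a.+1)) //=; congr (_ + _).
  by rewrite big_ltn.
have tail : \sum_(a.+1 <= i < T.+1) w i <= B%:R * w a.
  have -> : B%:R * w a = \sum_(a.+1 <= i < T.+1) w a.
    rewrite sumr_const_nat subSS mulr_natl /a subKn // ltnW //.
  by apply: ler_sum_nat => i /andP[ai _]; apply: wdec.
have := sumE w; rewrite w1 wT // add0r => S1.
have c := cauchy_seq R _ (index_iota 1 a.+1) w.
rewrite size_iota subSS subn0 in c.
have P2 : \sum_(1 <= i < a.+1) w i ^+ 2 <= P.
  rewrite /P (sumE (fun i => w i ^+ 2)) -addrA addrCA lerDl.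
  by rewrite addr_ge0 ?sqr_ge0 // sumr_ge0 // => i _; exact: sqr_ge0.
have ar : a%:R = T%:R - B%:R :> R by rewrite natrB // ltnW.
have d1 : d <= 1 by rewrite invf_le1 // ler1n.
have nd : n%:R * d = 1 by rewrite divff // gt_eqF.
have c1 : (1 - d / 2) ^+ 2 <= a%:R * P.
  apply: le_trans (le_trans c (ler_wpM2l (ler0n _ _) P2)).
  by rewrite lerXn2r ?nnegrE //; lra.
have k0 : 0 <= K1 by rewrite !mulr_ge0 // exprn_ge0.
have c2 : a%:R * P <= (n%:R - K1 - 2) * (d * (1 + K1 * d)).
  apply: ler_pM => //; last exact: sum_sqr_le.
  by rewrite ar; move: BK TK; set KK := K3; lra.
move: c2 k0; set k := K1 => c2 k0.
have : (n%:R - k - 2) * (d * (1 + k * d)) = 1 - 2 * d - (k + 2) * k * d ^+ 2.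
  have -> : (n%:R - k - 2) * (d * (1 + k * d)) =
    (n%:R * d) * (1 + k * d) - (k + 2) * d * (1 + k * d) by ring.
  by rewrite nd; ring.
have : 0 <= (k + 2) * k * d ^+ 2 by rewrite !mulr_ge0 ?sqr_ge0 //; lra.
have sq (z : R) : (1 - z / 2) ^+ 2 = 1 - z + z ^+ 2 / 4 by field.
have := sq d.
have : 0 <= d ^+ 2 := sqr_ge0 d.
by move: c1 c2 d0; lra.
Qed.

End Extremal.

(** * Exchanging the star of the last vertex for missing edges: loss and gain *)

Section Swap.
Variable R : realType.
Implicit Types (F : {fset {fset nat}}) (w : nat -> R).

Lemma wgtU w G F : [disjoint G & F]%fset -> wgt w (G `|` F) = wgt w G + wgt w F.
Proof.
move=> dGF; rewrite /wgt (big_fsetID _ (mem G)) /=; congr (_ + _).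
  by apply: eq_fbigl => e; rewrite !inE /=; case: (e \in G); rewrite ?andbF ?orbT.
apply: eq_fbigl => e; rewrite !inE /=.
have := fdisjointP dGF e; case: (e \in G) => //= [/(_ isT)/negbTE ->|_] //.
by rewrite andbT.
Qed.

(* Deleting the star of [T] costs [w T] times its link, which by the Lagrange condition
   is recovered to first order by rescaling. *)
Lemma wgt_swap_le r T G F w : is_rgraph r G -> is_rgraph r F -> weighting w ->
  wgt w G = lagrangian R G ->
  (forall H, is_rgraph r H -> #|` H| = #|` G| -> lagrangian R H <= lagrangian R G) ->
  (0 < T)%N -> 0 < w T < 1 -> (forall x, (T < x)%N -> w x = 0) ->
  [disjoint G & F]%fset -> (forall e, e \in F -> T \notin e) ->
  #|` F| = #|` link T G| ->
  wgt w F <= lagrangian R G * (4 ^+ r * w T ^+ 2).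
Proof.
move=> rG rF ww wG Gmax T0 /andP[wT0 wT1] wT dGF TF cF.
have [w0 [wp ws]] := ww.
(* The competitor, the union of [G0] and [F], avoids [T]; it is tested at [w] with coordinate [T]
   erased, of mass [1 - w T]. *)
set G0 := [fset e in G | T \notin e].
have dG0 : [disjoint G0 & F]%fset.
  by apply/fdisjointP => e; rewrite !inE /= => /andP[eG _]; exact: (fdisjointP dGF).
have rH : is_rgraph r (G0 `|` F).
  by move=> e; rewrite in_fsetU => /orP[|/rF//]; rewrite !inE /= => /andP[/rG].
have cH : #|` G0 `|` F| = #|` G|.
  rewrite cardfsU (_ : G0 `&` F = fset0) ?cardfs0 ?subn0; last exact/eqP.
  rewrite cF card_link !card_fset_sum1 [in RHS](big_fsetID _ (fun e : {fset nat} => T \in e)) /=.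
  by rewrite addnC.
have mass : \sum_(i < T.+1) upd w T 0 i = 1 - w T.
  have /= -> := sum_upd R id w T 0 T.+1 (ltnSn T); rewrite addr0; congr (_ - _).
  by have := series_finsupp _ _ T.+1 wT; move/cvg_unique; apply.
have := @lagrangian_finsupp R (upd w T 0) (G0 `|` F) r T.+1 rH.
rewrite mass => K.
have {K} : wgt (upd w T 0) (G0 `|` F) <= lagrangian R (G0 `|` F) * (1 - w T) ^+ r.
  apply: K; rewrite ?subr_gt0 //; rewrite /upd.
  - by case: eqP.
  - by move=> x; case: ifP.
  - by move=> x Tx; rewrite gtn_eqF // wT.
have E F' : (forall e, e \in F' -> T \notin e) -> wgt (upd w T 0) F' = wgt w F'.
  move=> TF'; apply: eq_wgt => e x /TF' Te xe; rewrite /upd.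
  by case: eqP xe => // ->; rewrite (negbTE Te).
rewrite E => [|e]; last by rewrite in_fsetU => /orP[|/TF//]; rewrite !inE => /andP[].
rewrite wgtU //.
have l0 : 0 <= lagrangian R G by rewrite -wG wgt_ge0.
have := Gmax _ rH cH; have := wgt_split R w T G; rewrite -/G0 wG.
rewrite (wgt_link_maximal R w G r T) //.
set l := lagrangian R G; set l' := lagrangian R _ => lE l'l h.
have x1 : -1 <= - w T <= 1 by apply/andP; split; lra.
have := expr1D_le R _ r x1; rewrite sqrrN => h2.
have h3 : l' * (1 - w T) ^+ r <= l * (1 - w T) ^+ r.
  by apply: ler_wpM2r => //; rewrite exprn_ge0 // subr_ge0 ltW.
have := ler_wpM2l l0 h2; rewrite -/l.
have -> : l * (1 + r%:R * - w T + 4 ^+ r * w T ^+ 2) =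
  l - w T * (r%:R * l) + l * (4 ^+ r * w T ^+ 2) by ring.
lra.
Qed.

(* Giving the last [B] vertices weight [T] and the others weight 1 makes every such set weigh
   at least [T ^ 2], while the total mass stays linear in [T]. *)
Lemma card_two_in_tail r T B F : (0 < T)%N -> kgraph r T F ->
  (forall f, f \in F -> (1 < count (fun x => T - B < x)%N (enum_fset f))%N) ->
  #|` F|%:R * T%:R ^+ 2 <= ((1 + B%:R) * T%:R) ^+ r :> R.
Proof.
move=> T0 kF F2; pose z (x : nat) : R := if (T - B < x)%N then T%:R else 1.
have T1 : 1 <= T%:R :> R by rewrite ler1n.
have z0 x : 0 <= z x by rewrite /z; case: ifP.
have := wgt_le_mass R z _ _ _ z0 kF.
have mass : \sum_(i < T) z i <= (1 + B%:R) * T%:R.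
  rewrite -(big_mkord xpredT z) (big_cat_nat (n := (T - B)%N)) ?leq_subr //= mulrDl mul1r.
  apply: lerD.
    rewrite (eq_big_nat _ _ (F2 := fun=> 1)) => [|i /andP[_ iT]].
      by rewrite sumr_const_nat subn0 ler_nat leq_subr.
    by rewrite /z ltnNge (ltnW iT).
  apply: (@le_trans _ _ (\sum_(T - B <= i < T) (T%:R : R))).
    by apply: ler_sum => i _; rewrite /z; case: ifP.
  rewrite sumr_const_nat -[leLHS]mulr_natl; apply: ler_wpM2r => //.
  by rewrite ler_nat leq_subLR addnC -leq_subLR.
have f1 : 1 <= r`!%:R :> R by rewrite ler1n fact_gt0.
have h1 : #|` F|%:R * T%:R ^+ 2 <= wgt z F.
  rewrite /wgt (_ : #|` F|%:R * _ = \sum_(f <- F) T%:R ^+ 2); last first.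
    by rewrite big_const_seq count_predT iter_addr_0 mulr_natl.
  rewrite big_seq [leRHS]big_seq; apply: ler_sum => f /F2 f2.
  rewrite /z -big_mkcond /= big_const_seq iter_mulr_1.
  by rewrite ler_weXn2l.
move=> h; apply: le_trans h1 _.
apply: (@le_trans _ _ (r`!%:R * wgt z F)).
  by rewrite ler_peMl // wgt_ge0.
apply: le_trans h _; rewrite lerXn2r ?nnegrE //; exact: sumr_ge0.
Qed.

(** At most one factor of each monomial drops from [a] to [b]; an edge with no vertex in [Q] only
    does better, as [b <= a]. *)
Lemma wgt_few_tail_ge k (Q : pred nat) F w (a b : R) : 0 <= b <= a ->
  (forall f, f \in F -> #|` f| = k.+1 /\ (count Q (enum_fset f) <= 1)%N) ->
  (forall f x, f \in F -> x \in f -> b <= w x /\ (~~ Q x -> a <= w x)) ->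
  #|` F|%:R * (b * a ^+ k) <= wgt w F.
Proof.
move=> /andP[b0 ba] F1 Fw; have a0 := le_trans b0 ba.
rewrite /wgt (_ : #|` F|%:R * _ = \sum_(f <- F) b * a ^+ k); last first.
  by rewrite big_const_seq count_predT iter_addr_0 mulr_natl.
rewrite big_seq [leRHS]big_seq; apply: ler_sum => f fF.
apply: (@le_trans _ _ (\prod_(x <- f) (if Q x then b else a))); last first.
  rewrite big_seq [leRHS]big_seq; apply: ler_prod => x xf.
  by have [h1 h2] := Fw f x fF xf; case: (boolP (Q x)) => [_|/h2 ->]; rewrite ?b0 ?a0.
have [fk fQ] := F1 f fF.
rewrite (bigID Q) /= (eq_bigr (fun=> b)) => [|x ->//].
rewrite [X in _ <= _ * X](eq_bigr (fun=> a)) => [|x /negbTE ->//].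
rewrite !big_const_seq !iter_mulr_1.
have := count_predC Q (enum_fset f); rewrite -[size _]/(#|` f|) fk.
move: fQ; case: (count Q _) => [|[|//]] _.
  rewrite add0n => ->; rewrite expr0 mul1r exprS; apply: ler_wpM2r => //.
  by rewrite exprn_ge0.
by rewrite add1n => -[->].
Qed.

End Swap.

(** Members of [G] inside [[1, T - 1]] avoid [T], so there are at most [|G|] minus the degree of [T]
    of them. At least that degree many of the ['C(T.-1, r)] sets are therefore missing. *)
Lemma exists_missing_edges r T G : is_rgraph r G -> (0 < T)%N ->
  (#|` G| <= 'C(T.-1, r))%N ->
  exists F : {fset {fset nat}},
    [/\ is_rgraph r F, kgraph r T F, [disjoint G & F]%fset & #|` F| = #|` link T G|].
Proof.
move=> rG T0 GT; set V : {fset nat} := [fset x in iota 1 T.-1].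
have VT x : x \in V -> (0 < x < T)%N.
  by rewrite in_iota_fset => /andP[-> /=]; rewrite -ltnS prednK.
have cG : (#|` G| = #|` link T G| + #|` [fset e in G | T \notin e]|)%N.
  rewrite card_link !card_fset_sum1.
  by rewrite [in LHS](big_fsetID _ (fun e : {fset nat} => T \in e)) /=.
have cI : (#|` ksets V r `&` G| <= #|` [fset e in G | T \notin e]|)%N.
  apply/fsubset_leq_card/fsubsetP => e; rewrite in_fsetI in_ksets => /andP[/andP[eV _] eG].
  rewrite in_fset [_ \in _]inE /= eG /=; apply/negP => /(fsubsetP eV)/VT.
  by rewrite ltnn andbF.
have [|F [_ FV cF]] := fset_between _ fset0 (ksets V r `\` G) #|` link T G| (fsub0set _).
  rewrite cardfs0 /= cardfsD card_ksets card_iota_fset.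
  rewrite leq_subRL; last by apply: leq_trans cI _; apply: leq_trans GT; rewrite cG leq_addl.
  by apply: leq_trans GT; rewrite cG addnC leq_add2l.
have FP f : f \in F -> [/\ f `<=` V, #|` f| = r & f \notin G].
  by move/(fsubsetP FV); rewrite in_fsetD in_ksets => /and3P[-> -> /eqP].
exists F; split=> // [f /FP[fV fr _]|f /FP[fV fr _]|].
- by split=> //; apply/negP => /(fsubsetP fV)/VT.
- by split=> // x /(fsubsetP fV)/VT /andP[].
by apply/fdisjointP => f fG; apply/negP => /FP[_ _]; rewrite fG.
Qed.

Lemma max_vertex G x : nonisolated G x ->
  exists T : nat, [/\ (x <= T)%N, nonisolated G T &
                      forall e y, e \in G -> y \in e -> (y <= T)%N].
Proof.
move=> [e0 e0G xe0].
pose Q y := has (fun e : {fset nat} => y \in e) (enum_fset G).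
have exQ : exists y, Q y by exists x; apply/hasP; exists e0.
have bQ y : Q y -> (y <= \max_(e <- G) \max_(z <- e) z)%N.
  move=> /hasP[e eG ye]; apply: (@leq_trans (\max_(z <- e) z)).
    exact: (@leq_bigmax_seq _ _ xpredT id).
  exact: (@leq_bigmax_seq _ _ xpredT (fun e : {fset nat} => \max_(z <- e) z)).
case: (ex_maxnP exQ bQ) => T /hasP[eT eTG TeT] Tmax.
exists T; split; first by apply: Tmax; apply/hasP; exists e0.
  by exists eT.
by move=> e y eG ye; apply: Tmax; apply/hasP; exists e.
Qed.

(* Gain against loss in the swap: [a = w (T - B)], [b = w T], [D] is the degree of [T], and [c] is
   the number of new edges with two points among the last [B] vertices. *)
Lemma swap_order_bound (R : realType) (p n T : nat) (q a b B D c : R) :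
  0 < n%:R :> R -> 0 < B -> 0 < b -> 0 <= a -> 0 <= c ->
  0 < T%:R :> R -> T%:R <= 2 * n%:R :> R ->
  n%:R ^+ p.+1 / 2 <= D * p.+1`!%:R ->
  c * T%:R ^+ 2 <= ((1 + B) * T%:R) ^+ p.+2 ->
  4 * p.+1`!%:R * (1 + B) ^+ p.+2 * 2 ^+ p <= n%:R ->
  n%:R^-1 / 2 <= B * a ->
  (D - c) * (b * a ^+ p.+1) <= 4 ^+ p.+2 * b ^+ 2 ->
  b <= q / n%:R ->
  n%:R <= 4 ^+ p.+2 * q * (4 * p.+1`!%:R * (2 * B) ^+ p.+1).
Proof.
move=> n0 B0 b0 a0 c0 T0 T2 hD hc hn ha hgain bq.
have f0 : 0 < p.+1`!%:R :> R by rewrite ltr0n fact_gt0.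
set f : R := p.+1`!%:R in f0 hD hn *.
have hc1 : c <= (1 + B) ^+ p.+2 * T%:R ^+ p.
  rewrite -(ler_pM2r (exprn_gt0 2 T0)) -mulrA -exprD addn2; apply: le_trans hc _.
  by rewrite exprMn.
have B1 : 0 <= (1 + B) ^+ p.+2 by rewrite exprn_ge0; lra.
have hc2 : c <= (1 + B) ^+ p.+2 * (2 ^+ p * n%:R ^+ p).
  apply: le_trans hc1 _; apply: ler_wpM2l => //; rewrite -exprMn.
  by rewrite lerXn2r ?nnegrE ?mulr_ge0 ?(ltW T0) ?(ltW n0).
have np0 : 0 <= n%:R ^+ p :> R by rewrite exprn_ge0.
have hc3 : 4 * f * c <= n%:R ^+ p.+1.
  have := ler_wpM2r np0 hn; rewrite -exprS; apply: le_trans.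
  have -> : 4 * f * (1 + B) ^+ p.+2 * 2 ^+ p * n%:R ^+ p =
     4 * f * ((1 + B) ^+ p.+2 * (2 ^+ p * n%:R ^+ p)) by ring.
  by apply: ler_wpM2l => //; rewrite mulr_ge0 // ltW.
(* The [c] discarded edges cost at most half of the lower bound for [D]. *)
have g1 : n%:R ^+ p.+1 <= 4 * f * (D - c).
  have -> : 4 * f * (D - c) = 4 * (D * f) - 4 * f * c by ring.
  by move: hD hc3; set N := n%:R ^+ p.+1; lra.
have h1 : (D - c) * a ^+ p.+1 <= 4 ^+ p.+2 * (q / n%:R).
  apply: (@le_trans _ _ (4 ^+ p.+2 * b)); last by apply: ler_wpM2l => //; rewrite exprn_ge0.
  rewrite -(ler_pM2r b0).
  have -> : 4 ^+ p.+2 * b * b = 4 ^+ p.+2 * b ^+ 2 by ring.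
  by have -> : (D - c) * a ^+ p.+1 * b = (D - c) * (b * a ^+ p.+1) by ring.
have h2 : n%:R^-1 ^+ p.+1 <= (2 * B) ^+ p.+1 * a ^+ p.+1.
  rewrite -exprMn; apply: lerXn2r; rewrite ?nnegrE ?invr_ge0 ?(ltW n0) //.
    by rewrite !mulr_ge0 // ltW.
  by move: ha; lra.
(* The powers of [n] in the degree and in [a ^+ p.+1] cancel; the factor [1 / n] left over from
   [b <= q / n] then bounds [n]. *)
have one : 1 <= 4 * f * (2 * B) ^+ p.+1 * ((D - c) * a ^+ p.+1).
  have -> : 4 * f * (2 * B) ^+ p.+1 * ((D - c) * a ^+ p.+1) =
    (4 * f * (D - c)) * ((2 * B) ^+ p.+1 * a ^+ p.+1) by ring.
  rewrite [leLHS](_ : 1 = n%:R ^+ p.+1 * n%:R^-1 ^+ p.+1); last first.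
    by rewrite -exprMn divff ?expr1n // gt_eqF.
  by apply: ler_pM => //; rewrite exprn_ge0 ?invr_ge0.
have M0 : 0 <= 4 * f * (2 * B) ^+ p.+1 by rewrite !mulr_ge0 ?exprn_ge0 ?mulr_ge0 // ltW.
have := le_trans one (ler_wpM2l M0 h1).
have -> : 4 * f * (2 * B) ^+ p.+1 * (4 ^+ p.+2 * (q / n%:R)) =
  (4 ^+ p.+2 * q * (4 * f * (2 * B) ^+ p.+1)) / n%:R by ring.
by rewrite ler_pdivlMr // mul1r.
Qed.

(** * Support of the maximal weighting, and the contradiction for large [t] *)

(** A vertex beyond [T] has an empty link, so positive weight there would contradict the Lagrange
    condition. Vertices up to [T] weigh at least [w T] by monotonicity. *)
Lemma maximal_support (R : realType) r T G (w : nat -> R) : is_rgraph r G ->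
  weighting w -> wgt w G = lagrangian R G -> 0 < r%:R * lagrangian R G ->
  decreasing_w w -> nonisolated G T -> 0 < w T ->
  (forall e y, e \in G -> y \in e -> (y <= T)%N) ->
  [/\ forall x, ~~ (0 < x <= T)%N -> w x = 0,
      \sum_(i < T.+1) w i = 1 &
      forall x, (0 < x <= T)%N -> wgt w (link x G) = r%:R * lagrangian R G].
Proof.
move=> rG ww wG rl wdec [eT eTG TeT] wT GT; have [w0 [wp ws]] := ww.
have w_gt x : (T < x)%N -> w x = 0.
  move=> Tx; apply: le_anti; rewrite wp andbT leNgt; apply/negP => wx.
  have x0 : (0 < x)%N by apply: leq_ltn_trans Tx.
  have := wgt_link_maximal R w G r x rG ww wG x0 wx.
  rewrite (_ : link x G = fset0) /wgt ?big_seq_fset0 => [E|]; first by rewrite -E ltxx in rl.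
  apply/eqP; rewrite -fsubset0; apply/fsubsetP => f /imfsetP[e /=].
  by rewrite !inE /= => /andP[/GT h /h]; rewrite leqNgt Tx.
split.
- by move=> [|x]; rewrite ?w0 //= -ltnNge => /w_gt.
- by have := series_finsupp _ _ T.+1 w_gt; move/cvg_unique; apply.
move=> x /andP[x0 xT]; apply: wgt_link_maximal => //; apply: lt_le_trans wT _.
by move: xT; rewrite leq_eqVlt => /predU1P[->//|]; apply: wdec.
Qed.

Theorem theorem4p1 (R : realType) (r : nat) (hr : (3 <= r)%N) :
  exists t0 : nat, forall t : nat, (t0 <= t)%N ->
    forall G : {fset {fset nat}}, is_rgraph r G ->
    ('C(t.-1, r) <= #|` G| <= 'C(t, r))%N ->
    (forall H : {fset {fset nat}}, is_rgraph r H -> #|` H| = #|` G| ->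
        lagrangian R H <= lagrangian R G) ->
    forall w : nat -> R, weighting w -> wgt w G = lagrangian R G ->
    decreasing_w w -> (forall x, nonisolated G x -> 0 < w x) ->
    within_t t G.
Proof.
case: r hr => [|[|p]] // _.
pose q : R := 'C(p.+2, 2)%:R.
pose K1 : R := 3 * p.+2%:R ^+ 4 * q.
pose K2 : R := 2 * q + p.+2%:R * K1.
pose K3 : R := 4 * K2 + 1.
have q0 : 1 <= q by rewrite ler1n bin_gt0.
have K10 : 0 <= K1 by rewrite !mulr_ge0 ?exprn_ge0 //; lra.
have K20 : 0 <= p.+2%:R * K1 by rewrite mulr_ge0.
have K2q : 2 * q <= K2 by rewrite /K2 lerDl.
have K30 : 1 <= K3 by rewrite /K3; lra.
pose B := Num.Def.archi_bound (K3 + K1 + 2).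
have BK : K3 + K1 + 2 <= B%:R by apply/ltW/archi_boundP; lra.
(* [E1] makes new edges with two vertices in the tail a minority; [E2] is the bound on [n] that the
   exchange forces. [C] below adds all thresholds, so that [n > C] exceeds each of them. *)
pose E1 : R := 4 * p.+1`!%:R * (1 + B%:R) ^+ p.+2 * 2 ^+ p.
pose E2 : R := 4 ^+ p.+2 * q * (4 * p.+1`!%:R * (2 * B%:R) ^+ p.+1).
have f4 : 0 <= 4 * p.+1`!%:R :> R by rewrite mulr_ge0.
have E10 : 0 <= E1.
  by apply: (mulr_ge0 (mulr_ge0 f4 (exprn_ge0 _ _)) (exprn_ge0 _ _)) => //.
have E20 : 0 <= E2.
  by apply: (mulr_ge0 (mulr_ge0 (exprn_ge0 _ _) _) (mulr_ge0 f4 (exprn_ge0 _ _))) => //.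
pose C : R := 2 * K2 + K3 + B%:R + p.+2%:R + E1 + E2.
exists (Num.Def.archi_bound C).+1 => t tC G rG Gt Gmax w ww wG wdec wpos.
have r0 : 2 <= p.+2%:R :> R by rewrite ler_nat.
have C0 : 0 <= C by rewrite /C; lra.
have [n tE] : exists n, t = n.+1 by case: t tC Gt => // n _ _; exists n.
rewrite tE /= in tC Gt *.
have nC : C < n%:R.
  by apply: lt_le_trans (archi_boundP C0) _; rewrite ler_nat.
have B0 : 0 < B%:R :> R by lra.
have np : 0 < n%:R :> R by apply: le_lt_trans nC.
have n0 : (0 < n)%N by rewrite -(ltr_nat R).
have rn : (p.+2 <= n)%N by rewrite -(ler_nat R); apply: ltW; move: nC; rewrite /C; lra.
have lge := lagrangian_extremal_ge R _ _ _ n0 rn rG Gt Gmax.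
have K2n : K2 / n%:R <= 2^-1 by rewrite ler_pdivrMr //; move: nC; rewrite /C; lra.
have qn : q / n%:R < 1 by rewrite ltr_pdivrMr //; move: nC; rewrite /C; lra.
have f0 : 0 < p.+2`!%:R :> R by rewrite ltr0n fact_gt0.
have lpos : 0 < lagrangian R G.
  by rewrite -(pmulr_rgt0 _ f0); apply: lt_le_trans lge; rewrite subr_gt0.
move=> e eG x xe; rewrite lt0n; have [_ e0] := rG e eG.
have -> /= : x != 0%N by apply/eqP => x0; rewrite x0 (negbTE e0) in xe.
rewrite leqNgt; apply/negP => nx.
have [T [xT TG GT]] : _ := max_vertex G x (ex_intro2 _ _ e eG xe).
have nT : (n.+1 < T)%N := leq_trans nx xT.
have T0 : (0 < T)%N by apply: leq_ltn_trans nT.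
have wT := wpos _ TG.
have rl : 0 < p.+2%:R * lagrangian R G by rewrite mulr_gt0.
have [w_out w1 wL] := maximal_support R _ _ _ _ rG ww wG rl wdec TG wT GT.
have [w0 [wp ws]] := ww.
have kG : kgraph p.+2 T.+1 G.
  by move=> f fG; split=> [|y yf]; [case: (rG f fG)|rewrite ltnS (GT f)].
have wle := weight_le R p n T G w _ kG wp w1 w_out wL lge.
have /andP[_ Gle] := Gt.
have Tle := support_le R p n T G w _ n0 kG wp w1 w_out wG wL lge Gle K2n.
have TT : (0 < T <= T)%N by rewrite T0 leqnn.
have K2n1 : K2 / n%:R <= 1 by lra.
have dT := deg_ge R p n T G w _ n0 kG wp w1 w_out wG wL lge T K2n1 TT.
rewrite -/q -/K1 -/K2 -/K3 in Tle dT.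
have BT : (B < T)%N.
  apply: ltn_trans nT; rewrite ltnS -(ler_nat R); apply: ltW; move: nC.
  by rewrite /C; lra.
have tail := weight_tail_ge R p n T G w _ n0 kG wp w1 w_out wG wL lge B BK Tle BT wdec.
(* Here [T > n.+1] is used: it gives ['C(n.+1, r) <= 'C(T.-1, r)]. *)
have [|F [rF kF dF cF]] := exists_missing_edges p.+2 T G rG T0.
  by apply: leq_trans Gle _; rewrite leq_bin2l // -ltnS prednK.
have wT01 : 0 < w T < 1 by rewrite wT (le_lt_trans (wle T)).
have w_gt y : (T < y)%N -> w y = 0 
  by move=> Ty; apply: w_out; rewrite (leqNgt y T) Ty andbF.
have FT f : f \in F -> T \notin f.
  by move=> /kF[_ fT]; apply/negP => /fT; rewrite ltnn.
have gain := wgt_swap_le R _ _ _ _ _ rG rF ww wG Gmax T0 wT01 w_gt dF FT cF.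
have l1 : lagrangian R G <= 1.
  have := wgt_le_mass R w _ _ _ wp kG; rewrite w1 expr1n wG.
  by apply: le_trans; rewrite ler_peMl ?ler1n ?fact_gt0 // ltW.
pose Q y := (T - B < y)%N.
(* Only [F1], the edges with at most one vertex among the last [B], counts towards the gain; [F2] is
   shown to be small. *)
pose F2 := [fset f in F | (1 < count Q (enum_fset f))%N].
pose F1 := [fset f in F | ~~ (1 < count Q (enum_fset f))%N].
have cFE : #|` F|%:R = #|` F2|%:R + #|` F1|%:R :> R.
  rewrite -natrD !card_fset_sum1; congr _%:R.
  exact: (big_fsetID _ (fun f : {fset nat} => 1 < count Q (enum_fset f))%N).
have bad : #|` F2|%:R * T%:R ^+ 2 <= ((1 + B%:R) * T%:R) ^+ p.+2 :> R.
  by apply: card_two_in_tail => // f; rewrite !inE /= => /andP[/kF].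
have aT : (0 < T - B)%N by rewrite subn_gt0.
have wle' y z : (0 < y)%N -> (y <= z)%N -> w z <= w y.
  by move=> y0; rewrite leq_eqVlt => /predU1P[->//|]; apply: wdec.
have good : #|` F1|%:R * (w T * w (T - B)%N ^+ p.+1) <= wgt w F1.
  apply: (wgt_few_tail_ge _ _ Q).
  - by rewrite wp wle' // leq_subr.
  - move=> f; rewrite !inE /= -leqNgt => /andP[/kF[-> _] ->] //.
  - move=> f y; rewrite !inE /= => /andP[fF _] yf.
    have y0 : (0 < y)%N by rewrite lt0n; apply/eqP => yE; case: (rF f fF); rewrite -yE yf.
    split; first by apply: wle' => //; case: (kF f fF) => _ /(_ y yf) /ltnW.
    by rewrite /Q -leqNgt => yB; apply: wle'.
have F1F : wgt w F1 <= wgt w F.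
  rewrite [leRHS](big_fsetID _ (fun f : {fset nat} => 1 < count Q (enum_fset f))%N) /=.
  by rewrite lerDr; apply: wgt_ge0.
have : n%:R <= E2.
  apply: (@swap_order_bound _ _ _ T q (w (T - B)%N) (w T) _ #|` link T G|%:R #|` F2|%:R).
  - by [].
  - by [].
  - by [].
  - by [].
  - by [].
  - by rewrite ltr0n.
  - by move: Tle nC; rewrite /C; lra.
  - apply: le_trans dT; apply: ler_wpM2l; first by rewrite exprn_ge0 // ltW.
    by lra.
  - by [].
  - by apply: ltW; move: nC; rewrite -/E1 /C; lra.
  - by [].
  - rewrite -cF cFE addrAC subrr add0r; apply: le_trans good _.
    apply: le_trans F1F _; apply: le_trans gain _.
    by rewrite ler_piMl // mulr_ge0 ?sqr_ge0 ?exprn_ge0.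
  - exact: wle.
by apply/negP; rewrite -ltNge; move: nC; rewrite /C; lra.
Qed.
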